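(* Let $d\in\{1,2,3\}$, let $\mathcal{R}$ be a finite interaction range and let $V\in C^3((\mathbb{R}^d)^{\mathcal{R}};\mathbb{R})$ be a site potential that is point symmetric with respect to $\neg$. Let $Y\in C^3(\mathbb{R}^d;\mathbb{R}^d)$ be a $1$-periodic deformation field and $P\in C^2(\mathbb{R}^d;\mathbb{R}^d)$ a $1$-periodic shift field (with some macroscopic strain $B\in \mathrm{GL}(d)$). For $N\in\mathbb{N}$ let $Y^N(x):=N\,Y(x/N)$, $P^N(x):=P(x/N)$, and let $y^N:\mathbb{Z}^d\times\{0,1\}\to\mathbb{R}^d$ be the atomistic deformation $$y^N_0(\xi):=Y^N(\xi)-\tfrac12 P^N(\xi),\qquad y^N_1(\xi):=Y^N(\xi)+\tfrac12P^N(\xi)\qquad(\xi\in\mathbb{Z}^d).$$ Then $$\left|N^{-d}\,\mathscr{E}^{\rm a}(y^N)-\mathscr{E}^{\rm c}(Y,P)\right|\le C\,N^{-2}\left\{\|\nabla^3Y\|_\infty+\|\nabla^2P\|_\infty+\|\nabla^2Y\|_\infty^2+\|\nabla P\|_\infty^2\right\},$$ where the constant $C$ depends only on $\mathcal{R}$ and $\|V\|_{C^2}$.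
   Context: Interaction range: $\mathcal{R}$ is a finite subset of $\mathbb{Z}^d\times\{0,1\}\times\{0,1\}\setminus\{(0;0,0),(0;1,1)\}$; its elements are written $\boldsymbol{\rho}=(\rho;\alpha,\beta)$. Atomistic energy: an atomistic deformation is a map $y:\mathbb{Z}^d\times\{0,1\}\to\mathbb{R}^d$, with $y_\alpha(\xi):=y(\xi,\alpha)$. Put $D_{\boldsymbol{\rho}}y(\xi):=y_\beta(\xi+\rho)-y_\alpha(\xi)$ and $D_{\mathcal{R}}y(\xi):=(D_{\boldsymbol{\rho}}y(\xi))_{\boldsymbol{\rho}\in\mathcal{R}}$. The deformation $y$ is $N$-periodic if $y_\alpha(\xi)=B\xi+u_\alpha(\xi)$ for some $B\in \mathrm{GL}(d)$ and some $u:\mathbb{Z}^d\times\{0,1\}\to\mathbb{R}^d$ with $u_\alpha(\xi+N\eta)=u_\alpha(\xi)$ for all $\xi,\eta\in\mathbb{Z}^d$. For an $N$-periodic deformation $y$, with $\Omega_N:=\{0,1,\dots,N-1\}^d$, $$\mathscr{E}^{\rm a}(y):=\sum_{\xi\in\Omega_N}V(D_{\mathcal{R}}y(\xi)).$$ Point symmetry with respect to $\neg$: let $\neg 0:=1$, $\neg1:=0$ and $\neg(\rho;\alpha,\beta):=(-\rho;\neg\alpha,\neg\beta)$. $V$ is point symmetric with respect to $\neg$ if $\neg\mathcal{R}=\mathcal{R}$ and $V(\{g_{\boldsymbol{\rho}}\}_{\boldsymbol{\rho}\in\mathcal{R}})=V(\{-g_{\neg\boldsymbol{\rho}}\}_{\boldsymbol{\rho}\in\mathcal{R}})$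 for all $\{g_{\boldsymbol{\rho}}\}\in(\mathbb{R}^d)^{\mathcal{R}}$. This is the symmetry of single-species $2$-lattices. Continuum fields: a pair $(Y,P)$ of a deformation field and a shift field on $\mathbb{R}^d$ is $N$-periodic if, for some $B\in\mathrm{GL}(d)$, $P(x+N\eta)=P(x)$ and $Y(x+N\eta)=NB\eta+Y(x)$ for all $x\in\mathbb{R}^d$, $\eta\in\mathbb{Z}^d$. Cauchy–Born energy: $\nabla_{\boldsymbol{\rho}}(Y,P)(x):=\nabla_\rho Y(x)+(\beta-\alpha)P(x)$, where $\nabla_\rho Y(x):=\nabla Y(x)\rho$, and $\nabla_{\mathcal{R}}(Y,P)(x):=\{\nabla_{\boldsymbol{\rho}}(Y,P)(x)\}_{\boldsymbol{\rho}\in\mathcal{R}}$. For a $1$-periodic pair $(Y,P)$, with $\Omega:=[0,1)^d$, $$\mathscr{E}^{\rm c}(Y,P):=\int_{\Omega}V(\nabla_{\mathcal{R}}(Y,P)(x))\,dx.$$ Norms: $\|\cdot\|_\infty$ is the supremum norm on $\mathbb{R}^d$; $\|V\|_{C^k}$ is the usual $C^k$ norm of $V$ (suprema of $V$ and its derivatives up to order $k$), taken to be finite. *)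

(* Defs.v *)
From HB Require Import structures.
From mathcomp Require Import all_boot all_order all_algebra finmap.
From mathcomp Require Import all_classical all_reals all_analysis.
Set Implicit Arguments.
Unset Strict Implicit.
Unset Printing Implicit Defensive.
Import Order.TTheory GRing.Theory Num.Theory.
Import numFieldNormedType.Exports.
Local Open Scope classical_set_scope.
Local Open Scope ring_scope.

Section smoothness.
Context {R : realType} {U W : normedModType R}.
Implicit Types (f : U -> W) (k : nat).

(* On finite-dimensional U, the usual C^k: all directional derivatives (hence,
   by linearity of the differential, f' itself) are C^(k-1). *)
Fixpoint Ck k f : Prop :=
  if k is k'.+1 then
    (forall x, differentiable f x) /\ (forall v : U, Ck k' (fun x => 'D_v f x))
  else continuous f.

Definition iter_derive (vs : seq U) f : U -> W :=
  foldr (fun v (g : U -> W) x => 'D_v g x) f vs.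

(* The supremum over x of the operator norm of the k-linear map
   (v_1, ..., v_k) |-> D_(v_1) ... D_(v_k) f x. On matrices and row vectors the
   ambient norm `| _ | is the maximum of the absolute values of the entries. *)
Definition derive_norm k f : \bar R :=
  ereal_sup [set e | exists x, exists2 vs : k.-tuple U,
    forall i, `|tnth vs i| <= 1 & e = `|iter_derive vs f x|%:E].

Definition Ck_norm k f : \bar R := (\sum_(j < k.+1) derive_norm j f)%E.

End smoothness.

Section product_cons.
Context {R : realType} {disp : measure_display} {T : measurableType disp}.

Definition tuple_cons n (z : T * n.-tuple T) : n.+1.-tuple T :=
  [tuple of z.1 :: z.2].

Lemma measurable_tuple_cons n : measurable_fun setT (@tuple_cons n).
Proof. exact: measurable_cons. Qed.

Section measure.
Context (n : nat) (nu : {sigma_finite_measure set T -> \bar R})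
  (mu : {sigma_finite_measure set (n.-tuple T) -> \bar R}).

(* The product of nu and mu, transported to (n+1)-tuples. *)
Definition product_cons : set (n.+1.-tuple T) -> \bar R :=
  pushforward (nu \x mu)%E (@tuple_cons n).

Let product_cons0 : product_cons set0 = 0%E.
Proof. by rewrite /product_cons /pushforward preimage_set0 measure0. Qed.

Let product_cons_ge0 A : (0 <= product_cons A)%E.
Proof. exact: (measure_ge0 (nu \x mu)%E). Qed.

Let product_cons_sigma_additive : semi_sigma_additive product_cons.
Proof.
move=> F mF tF mUF; rewrite /product_cons /pushforward preimage_bigcup.
have mpre A : measurable A -> measurable (@tuple_cons n @^-1` A).
  by move=> mA; rewrite -[X in measurable X]setTI; exact: measurable_tuple_cons.
apply: (@measure_semi_sigma_additive _ _ _ (nu \x mu)%E).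
- by move=> k; exact: mpre.
- apply/trivIsetP => /= i j _ _ ij; rewrite -preimage_setI.
  by move/trivIsetP : tF => /(_ _ _ _ _ ij) ->//; rewrite preimage_set0.
- by rewrite -preimage_bigcup; exact: mpre.
Qed.

HB.instance Definition _ := isMeasure.Build _ _ _ product_cons
  product_cons0 product_cons_ge0 product_cons_sigma_additive.

Let product_cons_sigma_finite : sigma_finite setT product_cons.
Proof.
have /sigma_finiteP[F [FT ndF Foo]] := sigma_finiteT nu.
have /sigma_finiteP[G [GT ndG Goo]] := sigma_finiteT mu.
pose hd (t : n.+1.-tuple T) : T := thead t.
pose tl (t : n.+1.-tuple T) : n.-tuple T := [tuple of behead t].
exists (fun k => (hd @^-1` F k) `&` (tl @^-1` G k)).
  apply/esym; rewrite -subTset => t _.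
  have : (\bigcup_k F k) (hd t) by rewrite -FT.
  have : (\bigcup_k G k) (tl t) by rewrite -GT.
  move=> [j _ Gj] [i _ Fi]; exists (maxn i j) => //; split.
  - by have /subsetPset := ndF _ _ (leq_maxl i j); exact.
  - by have /subsetPset := ndG _ _ (leq_maxr i j); exact.
move=> k; have [mF Fk] := Foo k; have [mG Gk] := Goo k; split.
  apply: measurableI; rewrite -[X in measurable X]setTI.
  - exact: (measurable_tnth ord0).
  - exact: measurable_behead.
rewrite /product_cons /pushforward.
rewrite (_ : _ @^-1` _ = F k `*` G k); last first.
  apply/seteqP; split=> -[x t] /=; rewrite /hd /tl /tuple_cons theadE /=.
  - case=> Fx; rewrite (_ : [tuple of _] = t)//; exact/val_inj.
  - case=> Fx Gt; split=> //; rewrite (_ : [tuple of _] = t)//; exact/val_inj.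
by rewrite product_measure1E// lte_mul_pinfty// ge0_fin_numE.
Qed.

HB.instance Definition _ := Measure_isSigmaFinite.Build _ _ _
  product_cons product_cons_sigma_finite.

End measure.

End product_cons.

Section lebesgue_tuple.
Context {R : realType}.
Local Notation T := (measurableTypeR R).

(* Lebesgue measure on R^n, realized on n-tuples (which carry the product
   sigma-algebra) as the n-fold product of the Lebesgue measure on R. *)
Fixpoint lebesgue_tuple n : {sigma_finite_measure set (n.-tuple T) -> \bar R} :=
  match n with
  | 0%N => dirac ([tuple] : 0.-tuple T)
  | n'.+1 => product_cons (@lebesgue_measure R) (lebesgue_tuple n')
  end.

End lebesgue_tuple.

(* ((rho, alpha), beta) encodes the bond (rho; alpha, beta), with false and true
   for the species 0 and 1. *)
Notation bond d := ('rV[int]_d * bool * bool)%type.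

Definition bond_neg d (b : bond d) : bond d :=
  let: (rho, alpha, beta) := b in (- rho, ~~ alpha, ~~ beta).

Definition interaction_range d (Rg : {fset bond d}) : Prop :=
  (0, false, false) \notin Rg /\ (0, true, true) \notin Rg.

Section energies.
Context {R : realType} {d : nat}.
Local Notation vec := 'rV[R]_d.
Local Notation site := 'rV[int]_d.

Definition emb (xi : site) : vec := map_mx intr xi.

(* The space (R^d)^Rg is 'M[R]_(#|{: Rg}|, d), one row for each bond of Rg.
   Its elements are all of the form stencil Rg g. *)
Definition stencil (Rg : {fset bond d}) (g : bond d -> vec) :
    'M[R]_(#|{: Rg}|, d) :=
  \matrix_(i < #|{: Rg}|) g (val (enum_val i)).

Definition point_symmetric (Rg : {fset bond d})
    (V : 'M[R]_(#|{: Rg}|, d) -> R) : Prop :=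
  [fset bond_neg b | b in Rg]%fset = Rg /\
  forall g : bond d -> vec,
    V (stencil Rg g) = V (stencil Rg (fun b => - g (bond_neg b))).

Definition finite_diff (y : site -> bool -> vec) (xi : site) (b : bond d) : vec :=
  let: (rho, alpha, beta) := b in y (xi + rho) beta - y xi alpha.

Definition atom_energy (Rg : {fset bond d}) (V : 'M[R]_(#|{: Rg}|, d) -> R)
    (N : nat) (y : site -> bool -> vec) : R :=
  \sum_(k : 'rV['I_N]_d)
    V (stencil Rg (finite_diff y (map_mx (fun i : 'I_N => (i : nat)%:Z) k))).

(* Vectors are rows, so B xi is written emb xi *m B^T. *)
Definition atom_periodic (N : nat) (y : site -> bool -> vec) : Prop :=
  exists2 B : 'M[R]_d, B \in unitmx &
  exists2 u : site -> bool -> vec,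
    forall xi eta alpha, u (xi + eta *+ N) alpha = u xi alpha &
    forall xi alpha, y xi alpha = emb xi *m B^T + u xi alpha.

Definition field_periodic (N : nat) (Y P : vec -> vec) : Prop :=
  exists2 B : 'M[R]_d, B \in unitmx &
  forall x (eta : site),
    P (x + N%:R *: emb eta) = P x /\
    Y (x + N%:R *: emb eta) = N%:R *: (emb eta *m B^T) + Y x.

Definition bond_grad (Y P : vec -> vec) (x : vec) (b : bond d) : vec :=
  let: (rho, alpha, beta) := b in 'd Y x (emb rho) + (beta%:R - alpha%:R) *: P x.

Definition unit_cell : set (d.-tuple (measurableTypeR R)) :=
  [set t | forall i, 0 <= (tnth t i : R) < 1].

Definition cb_energy (Rg : {fset bond d}) (V : 'M[R]_(#|{: Rg}|, d) -> R)
    (Y P : vec -> vec) : R :=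
  \int[lebesgue_tuple d]_(t in unit_cell)
    V (stencil Rg (bond_grad Y P (\row_i tnth t i))).

Definition scale_def (N : nat) (Y : vec -> vec) (x : vec) : vec :=
  N%:R *: Y (N%:R^-1 *: x).

Definition scale_shift (N : nat) (P : vec -> vec) (x : vec) : vec :=
  P (N%:R^-1 *: x).

Definition sampled_deformation (N : nat) (Y P : vec -> vec)
    (xi : site) (alpha : bool) : vec :=
  let YN := scale_def N Y (emb xi) in
  let PN := scale_shift N P (emb xi) in
  if alpha then YN + 2^-1 *: PN else YN - 2^-1 *: PN.

Lemma embD : {morph emb : xi eta / xi + eta}.
Proof. by move=> xi eta; rewrite /emb map_mxD. Qed.

Lemma embMn xi n : emb (xi *+ n) = n%:R *: emb xi.
Proof.
rewrite scaler_nat; elim: n => [|n IHn]; first by rewrite !mulr0n /emb map_mx0.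
by rewrite !mulrS embD IHn.
Qed.

Lemma sampled_deformation_periodic N Y P : (0 < N)%N ->
  field_periodic 1 Y P -> atom_periodic N (sampled_deformation N Y P).
Proof.
move=> N0 [B Bu YP]; exists B => //.
have N0' : N%:R != 0 :> R by rewrite pnatr_eq0 -lt0n.
exists (fun xi alpha => sampled_deformation N Y P xi alpha - emb xi *m B^T);
  last by move=> xi alpha; rewrite addrC subrK.
move=> xi eta alpha.
have [PE YE] := YP (N%:R^-1 *: emb xi) eta; rewrite !scale1r in PE YE.
have E : N%:R^-1 *: emb (xi + eta *+ N) = N%:R^-1 *: emb xi + emb eta.
  by rewrite embD embMn scalerDr scalerA mulVf// scale1r.
rewrite /sampled_deformation /scale_def /scale_shift E PE YE.
rewrite embD mulmxDl embMn scalerDr -scalemxAl.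
have addrBCK (a y p b : vec) : a + y + p - (b + a) = y + p - b.
  by rewrite [b + a]addrC opprD addrA -[a + y + p]addrA [a + _]addrC addrK.
by case: alpha; rewrite addrBCK.
Qed.

End energies.

(* Main.v *)
Require Import Defs.
From mathcomp Require Import all_boot all_order all_algebra finmap.
From mathcomp Require Import all_classical all_reals all_analysis.
From mathcomp Require Import measurable_realfun ring lra.
Import Order.TTheory GRing.Theory Num.Theory.
Import numFieldNormedType.Exports.
Local Open Scope classical_set_scope.
Local Open Scope ring_scope.

(** Write eps = 1/N, x = eps xi, G(x) for the stencil of the bond gradients of
    (Y, P) at x, and F(x) = V(G(x)) for the Cauchy-Born energy density.  The
    error splits into a pointwise modelling error, V of the finite differences
    at xi against F(x), and a quadrature error, the grid average of F against
    its integral over the unit cell.  Both are of second order.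

    Modelling error.  Expanding Y and P at x, the finite difference along a
    bond b = (rho; alpha, beta) is G_b + eps g_b + O(eps^2), where
    g_b = (1/2) D_rho D_rho Y + (beta - 1/2) D_rho P.  The first order term
    drops out of the energy: negating the bond leaves g_b unchanged and changes
    the sign of G_b, so that point symmetry makes t |-> V(G + t g) even, and
    DV(G)[g] = 0 ([point_symmetric_diff_eq0], [bond_grad_neg],
    [bond_defect_neg]).  What is left is bounded by the second derivative of V
    times the square of the O(eps) increment, which produces the squares of
    the norms of the second derivative of Y and of the first derivative of P,
    and by the first derivative of V times the O(eps^2) remainder, which
    produces the two higher norms ([site_energy_error]).

    Quadrature error.  F is 1-periodic, and along each coordinate axis it has
    first order Taylor expansions with a quadratic remainder controlled by the
    same four norms ([cb_density_periodic_quadratic]).  In dimension one the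
    grid average of a periodic function is the trapezoidal rule, which is of
    second order ([trapezoid_quadrature]); Fubini's theorem and induction on
    the dimension give the general case ([grid_quadrature]).  Quadratic
    remainders are preferred to second derivatives because they survive
    composition with V by plain estimates, and are stable under averaging.

    All vector-valued estimates reduce to the mean value theorem for the matrix
    entries along a line, since the norm is the maximum of the entries. *)

(** * Taylor estimates along a line *)

Section taylor_scalar.
Context {R : realType}.

(** The point 0 is an endpoint of the segment, which may lie on either side of
    it; the derivative is only required on the ball of radius `|t|, so that the
    bound K may depend on t when the lemma is iterated in Taylor estimates. *)
Lemma normr_sub_le_derive (f f' : R -> R) (K t : R) :
    (forall x : R, `|x| <= `|t| -> is_derive x 1 f (f' x)) ->
    (forall x : R, `|x| <= `|t| -> `|f' x| <= K) ->
  `|f t - f 0| <= K * `|t|.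
Proof.
move=> df bf.
have seg a b : (forall x, x \in `[a, b] -> `|x| <= `|t|) ->
    a <= b -> `|f b - f a| <= K * `|b - a|.
  move=> abt ab.
  have dfab x : x \in `]a, b[ -> is_derive x 1 f (f' x).
    by move=> xab; apply/df/abt/subset_itv_oo_cc.
  have cf : {within `[a, b], continuous f}.
    by apply: derivable_within_continuous => x /abt /df [].
  have [c /abt ct ->] := MVT_segment ab dfab cf.
  by rewrite normrM ler_wpM2r// bf.
have [t0|/ltW t0] := leP 0 t.
  rewrite -[in X in _ <= X](subr0 t); apply: seg => // x.
  by rewrite in_itv/= => /andP[x0 xt]; rewrite !ger0_norm.
rewrite distrC -[in X in _ <= X](normrN t) -[in X in _ <= X](sub0r t).
apply: seg => // x.
by rewrite in_itv/= => /andP[x0 xt]; rewrite !ler0_norm// lerN2.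
Qed.

End taylor_scalar.

Section taylor_line.
Context {R : realType} {U : normedModType R}.
Implicit Types (g : U -> R) (x u : U) (K t : R).

Lemma is_derive_line g x u : (forall y, derivable g y u) ->
  forall t, is_derive t 1 (fun s => g (x + s *: u)) ('D_u g (x + t *: u)).
Proof.
move=> dg t.
have E : (fun h : R => h^-1 *: (((fun s => g (x + s *: u)) \o shift t) (h *: 1)
            - g (x + t *: u))) =
         (fun h : R => h^-1 *: ((g \o shift (x + t *: u)) (h *: u) - g (x + t *: u))).
  apply/funext => h /=; congr (_ *: (g _ - _)).
  by rewrite [h *: 1]mulr1 scalerDl addrCA.
apply: DeriveDef; first by rewrite /derivable E; exact: dg.
by rewrite /derive E.
Qed.

Lemma line_lipschitz g u K : (forall y, derivable g y u) ->
    (forall y, `|'D_u g y| <= K) ->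
  forall x t, `|g (x + t *: u) - g x| <= K * `|t|.
Proof.
move=> dg bg x t.
have := @normr_sub_le_derive R _ _ K t (fun s _ => is_derive_line g x u dg s).
by rewrite scale0r addr0; apply=> s _; exact: bg.
Qed.

(** The constants K t^2 and K t^3 here and below are cruder than the optimal ones
    with 1/2 and 1/6: each order follows from the previous one, applied to the
    derivative, by one use of the mean value inequality. *)
Lemma line_taylor2 g u K : (forall y, derivable g y u) ->
    (forall y, derivable ('D_u g) y u) ->
    (forall y, `|'D_u ('D_u g) y| <= K) ->
  forall x t, `|g (x + t *: u) - g x - t * 'D_u g x| <= K * t ^+ 2.
Proof.
move=> dg dg2 bg x t.
have := @normr_sub_le_derive R
  (fun s => g (x + s *: u) - g x - s * 'D_u g x)
  (fun s => 'D_u g (x + s *: u) - 'D_u g x) (K * `|t|) t.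
rewrite scale0r addr0 subrr mul0r !subr0 -mulrA -expr2 real_normK ?num_real//.
apply.
- move=> s _; have ? := is_derive_line g x u dg s.
  apply: is_derive_eq.
  by rewrite subr0 scaler0 add0r [_%:A]mulr1.
- move=> s st; apply: le_trans (line_lipschitz _ _ _ dg2 bg x s) _.
  by rewrite ler_wpM2l// (le_trans _ (bg x)).
Qed.

Lemma line_taylor3 g u K : (forall y, derivable g y u) ->
    (forall y, derivable ('D_u g) y u) ->
    (forall y, derivable ('D_u ('D_u g)) y u) ->
    (forall y, `|'D_u ('D_u ('D_u g)) y| <= K) ->
  forall x t, `|g (x + t *: u) - g x - t * 'D_u g x
                - t ^+ 2 / 2 * 'D_u ('D_u g) x| <= K * `|t| ^+ 3.
Proof.
move=> dg dg2 dg3 bg x t.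
have := @normr_sub_le_derive R
  (fun s => g (x + s *: u) - g x - s * 'D_u g x - s ^+ 2 / 2 * 'D_u ('D_u g) x)
  (fun s => 'D_u g (x + s *: u) - 'D_u g x - s * 'D_u ('D_u g) x)
  (K * t ^+ 2) t.
have -> : K * t ^+ 2 * `|t| = K * `|t| ^+ 3.
  by rewrite -(real_normK (num_real t)) -mulrA -exprSr.
rewrite scale0r addr0 subrr expr0n/= !mul0r !subr0; apply.
- move=> s _; have ? := is_derive_line g x u dg s.
  have -> : (fun s => g (x + s *: u) - g x - s * 'D_u g x -
     s ^+ 2 / 2 * 'D_u ('D_u g) x) =
   (fun s => g (x + s *: u) - g x - s * 'D_u g x -
     (s * s) * (2^-1 * 'D_u ('D_u g) x)).
    by apply/funext => r; rewrite expr2 !mulrA.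
  apply: is_derive_eq.
  have E (a b c r : R) :
      a - 0 - (r * 0 + b * 1) - (r * r * 0 + 2^-1 * c * (r * 1 + r * 1)) =
      a - b - r * c by field.
  exact: E.
- move=> s st; apply: le_trans (line_taylor2 _ _ _ dg2 dg3 bg x s) _.
  rewrite ler_wpM2l//; first exact: le_trans (bg x).
  by rewrite -(real_normK (num_real s)) -(real_normK (num_real t))
    lerXn2r// nnegrE.
Qed.

End taylor_line.

Section taylor_line_mx.
Context {R : realType} {U : normedModType R} {m n : nat}.
Implicit Types (f : U -> 'M[R]_(m, n)) (x u : U) (K t : R).

Lemma mx_norm_leP (A : 'M[R]_(m, n)) (c : R) : 0 <= c ->
  reflect (forall i j, `|A i j| <= c) (`|A| <= c).
Proof.
move=> c0; rewrite [X in X <= _]/Num.Def.normr/= mx_normrE; apply: (iffP idP).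
  move=> H i j; apply: le_trans H.
  exact: (le_bigmax _ (fun p => `|A p.1 p.2|) (i, j)).
by move=> H; apply: bigmax_le => // -[i j] _; exact: H.
Qed.

Lemma le_mx_norm (A : 'M[R]_(m, n)) i j : `|A i j| <= `|A|.
Proof. exact: (mx_norm_leP A _ (normr_ge0 A) (lexx _)). Qed.

Lemma derive_coord f u i j x : derivable f x u ->
  'D_u (fun x => f x i j) x = 'D_u f x i j.
Proof. by move=> df; rewrite derive_mx// mxE. Qed.

Lemma derive_coordT f u i j : (forall y, derivable f y u) ->
  'D_u (fun x => f x i j) = (fun x => 'D_u f x i j).
Proof. by move=> df; apply/funext => x; exact: derive_coord. Qed.

Lemma derivable_coord f u i j : (forall y, derivable f y u) ->
  forall y, derivable (fun x => f x i j) y u.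
Proof. by move=> df y; move/derivable_mxP : (df y). Qed.

(** Differentiation commutes with taking an entry and the norm of a matrix is the
    maximum of its entries, so the scalar estimates hold with the same
    constants. *)
Lemma line_lipschitz_mx f u K : (forall y, derivable f y u) ->
    (forall y, `|'D_u f y| <= K) ->
  forall x t, `|f (x + t *: u) - f x| <= K * `|t|.
Proof.
move=> df bf x t; have K0 : 0 <= K by exact: le_trans (bf x).
apply/mx_norm_leP => [|i j]; first exact: mulr_ge0.
rewrite !mxE; apply: (line_lipschitz (fun x => f x i j)).
  exact: derivable_coord.
by move=> y; rewrite derive_coord//; exact: le_trans (le_mx_norm _ _ _) (bf y).
Qed.

Lemma line_taylor2_mx f u K : (forall y, derivable f y u) ->
    (forall y, derivable ('D_u f) y u) ->
    (forall y, `|'D_u ('D_u f) y| <= K) ->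
  forall x t, `|f (x + t *: u) - f x - t *: 'D_u f x| <= K * t ^+ 2.
Proof.
move=> df df2 bf x t; have K0 : 0 <= K by exact: le_trans (bf x).
apply/mx_norm_leP => [|i j]; first by rewrite mulr_ge0// sqr_ge0.
have -> A B C : (A - B - t *: C : 'M[R]_(m, n)) i j = A i j - B i j - t * C i j.
  by rewrite !mxE.
rewrite -(derive_coord f u i j x)//.
apply: (line_taylor2 (fun x => f x i j)); first exact: derivable_coord.
  rewrite (derive_coordT f u i j df); exact: (derivable_coord ('D_u f) u i j df2).
move=> y; rewrite (derive_coordT f u i j df) (derive_coord ('D_u f) u i j y)//.
exact: le_trans (le_mx_norm _ _ _) (bf y).
Qed.

Lemma line_taylor3_mx f u K : (forall y, derivable f y u) ->
    (forall y, derivable ('D_u f) y u) ->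
    (forall y, derivable ('D_u ('D_u f)) y u) ->
    (forall y, `|'D_u ('D_u ('D_u f)) y| <= K) ->
  forall x t, `|f (x + t *: u) - f x - t *: 'D_u f x
                - (t ^+ 2 / 2) *: 'D_u ('D_u f) x| <= K * `|t| ^+ 3.
Proof.
move=> df df2 df3 bf x t; have K0 : 0 <= K by exact: le_trans (bf x).
apply/mx_norm_leP => [|i j]; first by rewrite mulr_ge0// exprn_ge0.
have E1 := derive_coordT f u i j df.
have E2 := derive_coordT ('D_u f) u i j df2.
have -> A B C D : (A - B - t *: C - (t ^+ 2 / 2) *: D : 'M[R]_(m, n)) i j =
    A i j - B i j - t * C i j - t ^+ 2 / 2 * D i j by rewrite !mxE.
rewrite -(derive_coord f u i j x)// -(derive_coord ('D_u f) u i j x)// -E1.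
apply: (line_taylor3 (fun x => f x i j)); first exact: derivable_coord.
- rewrite E1; exact: (derivable_coord ('D_u f) u i j df2).
- rewrite E1 E2; exact: (derivable_coord ('D_u ('D_u f)) u i j df3).
- move=> y; rewrite E1 E2 (derive_coord ('D_u ('D_u f)) u i j y)//.
  exact: le_trans (le_mx_norm _ _ _) (bf y).
Qed.

End taylor_line_mx.

(** * The trapezoidal rule for periodic functions *)

Section trapezoid.
Context {R : realType}.
Implicit Types (h : R -> R) (K : R).
Local Notation mu := (@lebesgue_measure R).

(** A form of |h''| <= 2 K for 1-periodic h that mentions no derivative: h' is
    only an auxiliary slope.  Equality at 0 and 1 is all the periodicity that
    the trapezoidal rule sees. *)
Definition periodic_quadratic K h := h 1 = h 0 /\
  exists h' : R -> R, forall x y,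
    `|h y - h x - h' x * (y - x)| <= K * (y - x) ^+ 2.

Lemma periodic_quadratic_ge0 {K h} : periodic_quadratic K h -> 0 <= K.
Proof.
move=> [_ [h' /(_ 0 1)]]; rewrite subr0 expr1n !mulr1; exact/le_trans/normr_ge0.
Qed.

Lemma periodic_quadratic_continuous {K h} :
  periodic_quadratic K h -> continuous h.
Proof.
move=> pq; have K0 := periodic_quadratic_ge0 pq; case: pq => _ [h' hK] x.
pose c := `|h' x| + K + 1.
have c0 : 0 < c by rewrite ltr_wpDl// addr_ge0.
apply/cvgrPdist_le => /= e e0; near=> y.
have yx1 : `|y - x| <= 1.
  by rewrite distrC; near: y; apply: cvgr_dist_le => //; exact: cvg_id.
have yxe : `|y - x| <= e / c.
  rewrite distrC; near: y; apply: cvgr_dist_le; last exact: divr_gt0.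
  exact: cvg_id.
rewrite distrC -(subrK (h' x * (y - x)) (h y - h x)).
apply: le_trans (ler_normD _ _) _.
apply: le_trans (lerD (hK x y) (lexx _)) _.
rewrite normrM -real_normK ?num_real// expr2 mulrA -mulrDl.
rewrite ler_pdivlMr // mulrC in yxe; apply: le_trans yxe.
have Kyx : K * `|y - x| <= K by rewrite ler_piMr.
by rewrite ler_wpM2r// /c; lra.
Unshelve. all: by end_near. Qed.

Lemma continuous_integrable_itv h (a b : R) : continuous h ->
  mu.-integrable `[a, b] (EFin \o h).
Proof.
move=> ch; apply: continuous_compact_integrable; first exact: segment_compact.
exact: continuous_subspaceT.
Qed.

(* The base point -2 keeps all the points t in [-1, 2] that are needed in the
   interior of the interval of integration, where H is differentiable. *)
Let primitive h x := \int[mu]_(t in `[-2, x]) h t.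

Let is_derive_primitive h (x : R) : continuous h -> -1 <= x <= 2 ->
  is_derive x 1 (primitive h) (h x).
Proof.
move=> ch /andP[x1 x2].
have := @continuous_FTC1_closed R h (-2) x 3.
have x3 : x < 3 by lra. have x_2 : -2 < x by lra.
move=> /(_ x3 (continuous_integrable_itv _ _ _ ch) x_2 (ch x)) [dx <-].
by apply: DeriveDef; [exact: dx|rewrite derive1E].
Qed.

Let primitiveE h : continuous h ->
  \int[mu]_(x in `[0, 1[) h x = primitive h 1 - primitive h 0.
Proof.
move=> ch; have ih a b := continuous_integrable_itv h a b ch.
rewrite /primitive Rintegral_itvB//; last by rewrite bnd_simp; lra.
- rewrite Rintegral_itv_bndo_bndc.
    rewrite -Rintegral_itv_obnd_cbnd//.
    by apply: integrableS (ih 0 1) => //; exact: subset_itv_oc_cc.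
  by apply: integrableS (ih 0 1) => //; exact: subset_itv_co_cc.
- by rewrite bnd_simp; lra.
Qed.

(** With H a primitive of h, both H(a + e) and h(a + e) are expanded at a; the
    terms in h(a) and h'(a) cancel. *)
Lemma trapezoid_rule h K (a e : R) (H : R -> R) (h' : R -> R) :
    (forall t : R, `|t| <= e -> is_derive (a + t) 1 H (h (a + t))) ->
    (forall x y, `|h y - h x - h' x * (y - x)| <= K * (y - x) ^+ 2) -> 0 <= e ->
  `|H (a + e) - H a - e * (h a + h (a + e)) / 2| <= 2 * K * e ^+ 3.
Proof.
move=> dH hK e0.
have K0 : 0 <= K by have := hK 0 1; rewrite subr0 expr1n !mulr1; exact/le_trans/normr_ge0.
have S := @normr_sub_le_derive R
  (fun t => H (a + t) - H a - t * h a - t * t * (2^-1 * h' a))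
  (fun t => h (a + t) - h a - t * h' a) (K * e ^+ 2) e.
have addKa (r : R) : a + r - a = r by ring.
have T := hK a (a + e); rewrite addKa in T.
suff : `|H (a + e) - H a - e * h a - e * e * (2^-1 * h' a)| <= K * e ^+ 3.
  move=> T2.
  (* The trapezoidal error is the Taylor error of H minus e/2 times that of h. *)
  have -> : H (a + e) - H a - e * (h a + h (a + e)) / 2 =
    H (a + e) - H a - e * h a - e * e * (2^-1 * h' a)
     - e / 2 * (h (a + e) - h a - h' a * e) by field.
  apply: le_trans (ler_normB _ _) _.
  rewrite normrM (ger0_norm (_ : 0 <= e / 2)) ?divr_ge0//.
  have T3 : e / 2 * `|h (a + e) - h a - h' a * e| <= e / 2 * (K * e ^+ 2).
    by rewrite ler_wpM2l// divr_ge0.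
  have T4 : 0 <= K * e ^+ 3 by rewrite mulr_ge0// exprn_ge0.
  have T5 : e / 2 * (K * e ^+ 2) = K * e ^+ 3 / 2 by field.
  by rewrite T5 in T3; lra.
have -> : K * e ^+ 3 = K * e ^+ 2 * `|e| by rewrite (ger0_norm e0); ring.
move: S; rewrite addr0 subrr !mul0r !subr0; apply.
- move=> t; rewrite (ger0_norm e0) => /dH dHt.
  have ? : is_derive t 1 (fun t => H (a + t)) (h (a + t)).
    have dD : is_derive t 1 (fun s : R => a + s) 1.
      by apply: is_derive_eq; rewrite add0r mulr1.
    by have := is_derive1_comp dHt dD; rewrite mulr1.
  apply: is_derive_eq.
  have E (b c d r : R) :
      b - 0 - (r * 0 + c * 1) - (r * r * 0 + 2^-1 * d * (r * 1 + r * 1)) =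
      b - c - r * d by field.
  exact: E.
- move=> t; rewrite (ger0_norm e0) => te.
  have := hK a (a + t); rewrite addKa mulrC => /le_trans; apply.
  by rewrite ler_wpM2l// -(real_normK (num_real t)) lerXn2r// nnegrE.
Qed.

(** Periodicity turns the sum of the trapezoids into the plain grid average, and
    the integral telescopes along a primitive. *)
Lemma trapezoid_quadrature K h (N : nat) : (0 < N)%N -> periodic_quadratic K h ->
  `|\int[mu]_(x in `[0, 1[) h x - N%:R^-1 * \sum_(j < N) h (j%:R / N%:R)|
    <= 2 * K * N%:R ^- 2.
Proof.
move=> N0 pq; have ch := periodic_quadratic_continuous pq.
case: pq => h10 [h' hK]; rewrite primitiveE//.
set H := primitive h; pose e : R := N%:R^-1; pose p j : R := j%:R * e.
have Nr0 : N%:R != 0 :> R by rewrite pnatr_eq0 -lt0n.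
have e0 : 0 <= e by rewrite invr_ge0.
have e1 : e <= 1 by rewrite invf_le1 ?ltr0n// ler1n.
have pS j : p j.+1 = p j + e by rewrite /p -natr1 mulrDl mul1r.
have pN : p N = 1 by rewrite /p divff.
have p0 : p 0%N = 0 by rewrite /p mul0r.
have step (j : 'I_N) :
    `|H (p j.+1) - H (p j) - e * (h (p j) + h (p j.+1)) / 2| <= 2 * K * e ^+ 3.
  rewrite pS; apply: (@trapezoid_rule h K (p j) e H h') => // t te.
  apply: is_derive_primitive => //.
  have pj0 : 0 <= p j by rewrite mulr_ge0.
  have pj1 : p j <= 1 by rewrite -pN ler_wpM2r// ler_nat ltnW.
  by move: te; rewrite ler_norml => /andP[]; lra.
have -> : H 1 - H 0 = \sum_(j < N) (H (p j.+1) - H (p j)).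
  by rewrite -(big_mkord xpredT (fun j => H (p j.+1) - H (p j)))
    telescope_sumr// pN p0.
have -> : e * \sum_(j < N) h (p j) =
    \sum_(j < N) e * (h (p j) + h (p j.+1)) / 2.
  have shift_sum : \sum_(j < N) h (p j.+1) = \sum_(j < N) h (p j).
    apply: (@addrI _ (h (p 0%N))).
    rewrite -(big_mkord xpredT (fun j => h (p j))).
    rewrite -(big_mkord xpredT (fun j => h (p j.+1))).
    rewrite -(big_nat_recl N 0%N (fun j => h (p j)))// big_nat_recr//=.
    by rewrite pN p0 h10 addrC.
  by rewrite -mulr_suml -mulr_sumr big_split/= shift_sum; field.
rewrite -sumrB; apply: le_trans (ler_norm_sum _ _ _) _.
apply: le_trans (ler_sum _ (fun j _ => step j)) _.
rewrite sumr_const card_ord -exprVn -/e -[leLHS]mulr_natr.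
have -> : 2 * K * e ^+ 3 * N%:R = 2 * K * p N * e ^+ 2 by rewrite /p; ring.
by rewrite pN mulr1.
Qed.

End trapezoid.

(** * Measurability and Fubini on tuples *)

Section tuple_measurability.
Context {R : realType}.
Local Notation T := (measurableTypeR R).

Lemma measurable_coordwise n (A : 'I_n -> set T) :
  (forall i, measurable (A i)) ->
  measurable [set t : n.-tuple T | forall i, A i (tnth t i)].
Proof.
move=> mA.
have -> : [set t : n.-tuple T | forall i, A i (tnth t i)] =
    \bigcap_(i in [set: 'I_n]) ((@tnth n T)^~ i @^-1` A i).
  by apply/seteqP; split=> t /= H i => [_|]; exact: H.
apply: fin_bigcap_measurable; first exact: finite_finset.
move=> i _; rewrite -[X in measurable X]setTI; exact: measurable_tnth.
Qed.

Lemma measurable_unit_cell n : measurable (@unit_cell R n).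
Proof.
have -> : @unit_cell R n =
    [set t : n.-tuple T | forall i, (`[0, 1[%classic : set R) (tnth t i)].
  by apply/seteqP; split=> t /= H i; move: (H i); rewrite in_itv.
by apply: (@measurable_coordwise n (fun=> `[0, 1[%classic)) => i; exact: measurable_itv.
Qed.

(** The sigma-algebra on tuples is the product one, so topological continuity is
    not directly usable.  A superlevel set of f is the union of the countably
    many rational boxes on which the Lipschitz bound guarantees the level. *)
Lemma measurable_lipschitz n (f : n.-tuple T -> R) (L : R) : 0 <= L ->
    (forall (s t : n.-tuple T) (r : R), 0 <= r ->
      (forall i, `|(tnth s i : R) - tnth t i| <= r) -> `|f s - f t| <= L * r) ->
  measurable_fun setT f.
Proof.
move=> L0 fL.
pose ball_at (q : n.-tuple rat) (m : nat) := [set t : n.-tuple T |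
  forall i, (ball (ratr (tnth q i) : R) (m.+1%:R^-1 : R)) (tnth t i)].
have mball q m : measurable (ball_at q m).
  apply: (@measurable_coordwise n
    (fun i => ball (ratr (tnth q i) : R) (m.+1%:R^-1 : R))) => i.
  exact: measurable_ball.
(* Moving to a rational point within r and back again costs L r twice. *)
have margin (y z a L' r : R) : r * (2 * L' + 1) < z - a -> 0 < r ->
    z - y <= L' * r -> a < y - L' * r.
  move=> zr r0 yz; have rL : r * (2 * L' + 1) = 2 * (L' * r) + r by ring.
  by lra.
apply: (measurability _ (RGenOInfty.measurableE R)) => // _ [_ [a ->] <-].
rewrite setTI.
pose F (p : n.-tuple rat * nat) :=
  if a < f (map_tuple ratr p.1 : n.-tuple T) - L * p.2.+1%:R^-1
  then ball_at p.1 p.2 else set0.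
have -> : f @^-1` `]a, +oo[%classic = \bigcup_(p in setT) F p.
  apply/seteqP; split=> t /=; rewrite in_itv/= andbT.
    move=> aft.
    have r0 : 0 < (f t - a) / (2 * L + 1).
      by rewrite divr_gt0 ?subr_gt0// ltr_wpDl// mulr_ge0.
    have [m] := ltr_add_invr r0; rewrite add0r ltr_pdivlMr; last first.
      by rewrite ltr_wpDl// mulr_ge0.
    have m0 : 0 < m.+1%:R^-1 :> R by rewrite invr_gt0.
    set r := m.+1%:R^-1 in m0 *; move=> mr.
    have dense i : exists q : rat, `|(tnth t i : R) - ratr q| < r.
      have [|q] := @rat_in_itvoo R (tnth t i) (tnth t i + r).
        by rewrite ltrDl.
      rewrite in_itv/= => /andP[q1 q2]; exists q.
      by rewrite ltr_norml; lra.
    pose q : n.-tuple rat := [tuple sval (cid (dense i)) | i < n].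
    have qt i : `|(tnth t i : R) - ratr (tnth q i)| < r.
      by rewrite tnth_mktuple; exact: svalP (cid (dense i)).
    exists (q, m) => //; rewrite /F/= ifT; last first.
      have := fL t (map_tuple ratr q : n.-tuple T) r (ltW m0).
      have H i : `|(tnth t i : R) - tnth (map_tuple ratr q : n.-tuple T) i| <= r.
        by rewrite tnth_map ltW.
      move=> /(_ H); rewrite ler_norml -/r => /andP[_ ftq].
      exact: margin mr m0 ftq.
    by move=> i; rewrite /ball/= distrC.
  move=> [[q m] _]; rewrite /F/=; case: ifPn => // aq tq.
  have := fL (map_tuple ratr q : n.-tuple T) t m.+1%:R^-1.
  have H i : `|(tnth (map_tuple ratr q : n.-tuple T) i : R) - tnth t i|
      <= m.+1%:R^-1.
    by rewrite tnth_map ltW//; exact: tq.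
  rewrite invr_ge0 ler0n => /(_ isT H); rewrite ler_norml => /andP[_ ftq].
  by apply: lt_le_trans aq _; rewrite lerBlDr -lerBlDl.
apply: (@countable_bigcupT_measurable _ _ _ F) => [|p].
  exact: countableP.
by rewrite /F; case: ifP.
Qed.

End tuple_measurability.

Section tuple_fubini.
Context {R : realType}.
Local Notation T := (measurableTypeR R).
Local Notation mu := (@lebesgue_measure R).
Local Notation lam n := (@lebesgue_tuple R n).

Lemma preimage_unit_cell n : tuple_cons (n := n) @^-1` (@unit_cell R n.+1) =
  (`[0, 1[%classic : set T) `*` @unit_cell R n.
Proof.
apply/seteqP; split=> -[x t] /=.
  move=> H; split=> [|i]; first by have := H ord0; rewrite tnth0 in_itv.
  by have := H (lift ord0 i); rewrite tnthS.
move=> [x01 tc] i; case: (unliftP ord0 i) => [j ->|->].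
  by rewrite tnthS; exact: tc.
by rewrite tnth0; rewrite in_itv in x01.
Qed.

Lemma lebesgue_unit_interval : mu (`[0, 1[%classic : set T) = 1%E.
Proof. by rewrite lebesgue_measure_itv/= lte_fin ltr01 oppr0 adde0. Qed.

Lemma lebesgue_unit_cell n : lam n (@unit_cell R n) = 1%E.
Proof.
elim: n => [|n IHn]; first by rewrite /= diracE mem_set// => -[].
rewrite /= /product_cons /pushforward preimage_unit_cell product_measure1E//=.
- rewrite -[X in (X * _)%E]/(mu (`[0, 1[%classic : set T)).
  by rewrite lebesgue_unit_interval IHn mule1.
- exact: measurable_unit_cell.
Qed.

Lemma integrable_unit_cell n (g : n.-tuple T -> R) (B : R) :
    measurable_fun setT g -> (forall t, `|g t| <= B) ->
  (lam n).-integrable (@unit_cell R n) (EFin \o g).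
Proof.
move=> mg gB; apply: measurable_bounded_integrable => //.
- exact: measurable_unit_cell.
- suff: (lam n (@unit_cell R n) < +oo)%E by [].
  by rewrite lebesgue_unit_cell ltry.
- exact: measurable_funTS.
- exists B; split; first exact: num_real.
  by move=> x Bx z _; exact/ltW/(le_lt_trans (gB _)).
Qed.

Lemma measurable_cons_slice n (f : n.+1.-tuple T -> R) (x : T) :
  measurable_fun setT f ->
  measurable_fun setT (fun t : n.-tuple T => f [tuple of x :: t]).
Proof.
move=> mf; apply: (measurableT_comp mf).
by apply: (@measurable_cons _ _ (n.-tuple T) T (fun=> x) n id).
Qed.

Section cons.
Variables (n : nat) (f : n.+1.-tuple T -> R) (B : R).
Hypotheses (mf : measurable_fun setT f) (fB : forall t, `|f t| <= B).

Let fcons (z : T * n.-tuple T) : R := f (tuple_cons z).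

Let mfcons : measurable_fun setT fcons.
Proof. by apply: measurableT_comp mf _; exact: measurable_tuple_cons. Qed.

Let D := (`[0, 1[%classic : set T) `*` @unit_cell R n.

Let mD : measurable D.
Proof. apply: measurableX => //; exact: measurable_unit_cell. Qed.

Let integrable_fcons : (mu \x lam n)%E.-integrable D (EFin \o fcons).
Proof.
apply: measurable_bounded_integrable => //.
- suff D1 : (mu \x lam n)%E D = 1%E.
    have : ((mu \x lam n)%E D < +oo)%E by rewrite D1 ltry.
    exact.
  rewrite product_measure1E//; last exact: measurable_unit_cell.
  rewrite -[RHS]mule1; congr (_ * _)%E; first exact: lebesgue_unit_interval.
  exact: lebesgue_unit_cell.
- exact: measurable_funTS.
- exists B; split; first exact: num_real.
  by move=> x Bx z _; exact/ltW/(le_lt_trans (fB _)).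
Qed.

(** Fubini's theorem, the restriction to the cell being moved into the integrand
    so that it applies on the whole product space. *)
Lemma integral_unit_cell_cons :
  [/\ mu.-integrable `[0, 1[ (fun x =>
        (\int[lam n]_(t in @unit_cell R n) f [tuple of x :: t])%:E)
    & \int[lam n.+1]_(t in @unit_cell R n.+1) f t =
      \int[mu]_(x in `[0, 1[)
        \int[lam n]_(t in @unit_cell R n) f [tuple of x :: t]].
Proof.
have gi : (mu \x lam n)%E.-integrable setT ((EFin \o fcons) \_ D).
  by rewrite -integrable_mkcond.
have inner x : (\int[lam n]_t ((EFin \o fcons) \_ D) (x, t))%E =
    ((fun x => (\int[lam n]_(t in @unit_cell R n) f [tuple of x :: t])%:E)
      \_ (`[0, 1[%classic : set T)) x.
  rewrite patchE; case: ifPn => x01.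
    rewrite fineK; last first.
      apply: integrable_fin_num; first exact: measurable_unit_cell.
      apply: (@integrable_unit_cell n (fun t => f [tuple of x :: t]) B) => //.
      exact: measurable_cons_slice.
    rewrite [in RHS]integral_mkcond; apply: eq_integral => t _.
    rewrite !patchE; congr (if _ then _ else _).
    apply/idP/idP; rewrite !inE; first by case.
    by move=> tc; split=> //=; rewrite inE in x01.
  apply: integral0_eq => t _; rewrite patchE ifF//.
  by apply/negbTE; apply: contra x01; rewrite !inE => -[].
split.
  rewrite integrable_mkcond//.
  have := integrable_fubini_F gi; congr (_.-integrable _ _).
  by apply/funext => x; exact: inner.
rewrite /Rintegral; congr fine.
transitivity (\int[pushforward (mu \x lam n) (@tuple_cons _ T n)]_(t in
  @unit_cell R n.+1) (EFin \o f) t)%E; first by [].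
rewrite integral_pushforward; last exact: measurable_unit_cell.
- rewrite preimage_unit_cell integral_mkcond -[LHS]integral12_prod_meas1//.
  rewrite [RHS]integral_mkcond; apply: eq_integral => x _; exact: inner.
- exact: measurable_tuple_cons.
- exact/measurable_EFinP.
- by rewrite preimage_unit_cell.
Qed.

End cons.
End tuple_fubini.

(** * Quadrature on the uniform grid *)

Section grid.
Context {R : realType}.
Local Notation T := (measurableTypeR R).
Local Notation mu := (@lebesgue_measure R).
Local Notation lam n := (@lebesgue_tuple R n).

(** The average of the slopes is a slope of the average. *)
Lemma periodic_quadratic_average (N : nat) (K : R) (h : 'I_N -> R -> R) :
  (0 < N)%N -> (forall j, periodic_quadratic K (h j)) ->
  periodic_quadratic K (fun x => N%:R^-1 * \sum_(j < N) h j x).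
Proof.
move=> N0 pq; split.
  by congr (_ * _); apply: eq_bigr => j _; case: (pq j).
pose h' j := sval (cid (pq j).2).
have hK j : forall x y, `|h j y - h j x - h' j x * (y - x)| <= K * (y - x) ^+ 2.
  exact: svalP (cid (pq j).2).
exists (fun x => N%:R^-1 * \sum_(j < N) h' j x) => x y.
rewrite -mulrBr -mulrA -mulrBr mulr_suml -!sumrB normrM gtr0_norm; last first.
  by rewrite invr_gt0 ltr0n.
rewrite ler_pdivrMl ?ltr0n//; apply: le_trans (ler_norm_sum _ _ _) _.
apply: le_trans (ler_sum _ (fun j _ => hK j x y)) _.
by rewrite sumr_const card_ord [leRHS]mulr_natl.
Qed.

(** Defined by recursion on the dimension, to follow the iterated integrals given
    by Fubini's theorem; [grid_averageE] is the closed form. *)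
Fixpoint grid_average (N n : nat) : (n.-tuple T -> R) -> R :=
  if n is n'.+1 then fun f => N%:R^-1 *
    \sum_(j < N) grid_average N n' (fun t => f [tuple of (j%:R / N%:R : R) :: t])
  else fun f => f [tuple].

Lemma periodic_quadratic_grid_average (N n : nat) (K : R)
    (g : R -> n.-tuple T -> R) : (0 < N)%N ->
    (forall t, periodic_quadratic K (g^~ t)) ->
  periodic_quadratic K (fun x => grid_average N n (g x)).
Proof.
move=> N0; elim: n g => [|n IHn] g pq /=; first exact: pq.
by apply: periodic_quadratic_average => // j; apply: IHn => t; exact: pq.
Qed.

(** With x the first coordinate, A x the integral of the slice at x and G x its
    grid average, A - G is controlled by the induction hypothesis, while G is
    again periodic with quadratic remainders, so that the trapezoidal rule
    applies to it. *)
Lemma grid_quadrature (N n : nat) (K B : R) (f : n.-tuple T -> R) : (0 < N)%N ->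
    measurable_fun setT f -> (forall t, `|f t| <= B) ->
    (forall i (t : n.-tuple T), periodic_quadratic K
      (fun s : R => f [tuple if j == i then s else tnth t j | j < n])) ->
  `|\int[lam n]_(t in @unit_cell R n) f t - grid_average N n f|
    <= n%:R * (2 * K * N%:R ^- 2).
Proof.
move=> N0; elim: n f => [|n IHn] f mf fB pqf.
  rewrite mul0r /Rintegral integral_dirac//=; last 2 first.
  - exact: measurable_unit_cell.
  - by apply/measurable_EFinP; exact: measurable_funTS.
  by rewrite indicE mem_set ?mul1r ?subrr ?normr0// => -[].
have pq_head (t : n.-tuple T) :
    periodic_quadratic K (fun s : R => f [tuple of (s : T) :: t]).
  have := pqf ord0 [tuple of (0 : T) :: t]; congr (periodic_quadratic _ _).
  apply/funext => s; congr f; apply: eq_from_tnth => j; rewrite tnth_mktuple.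
  by case: (unliftP ord0 j) => [k ->|->]; rewrite ?tnthS ?tnth0.
pose A (x : T) := \int[lam n]_(t in @unit_cell R n) f [tuple of x :: t].
pose G (x : T) := grid_average N n (fun t => f [tuple of x :: t]).
have [iA ->] := @integral_unit_cell_cons R n f B mf fB; rewrite -/A.
have pqG : periodic_quadratic K G by exact: periodic_quadratic_grid_average.
have AG x : `|A x - G x| <= n%:R * (2 * K * N%:R ^- 2).
  apply: IHn => [|t|i t]; first exact: measurable_cons_slice.
  - exact: fB.
  - have := pqf (lift ord0 i) [tuple of x :: t].
    congr (periodic_quadratic _ _); apply/funext => s; congr f.
    apply: eq_from_tnth => j; rewrite tnth_mktuple.
    case: (unliftP ord0 j) => [k ->|->]; rewrite ?tnthS ?tnth0//=.
    by rewrite tnth_mktuple (inj_eq lift_inj).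
have iG : mu.-integrable `[0, 1[ (EFin \o G).
  apply: integrableS (continuous_integrable_itv G 0 1 _) => //.
    exact: subset_itv_co_cc.
  exact: periodic_quadratic_continuous pqG.
set IA := \int[mu]_(x in _) _; pose IG := \int[mu]_(x in `[0, 1[) G x.
rewrite -[IA](subrK IG) -addrA; apply: le_trans (ler_normD _ _) _.
rewrite -natr1 mulrDl mul1r lerD//; last exact: trapezoid_quadrature.
rewrite /IA /IG -RintegralB//.
have iAG : mu.-integrable `[0, 1[ (EFin \o (fun x => A x - G x)).
  have : mu.-integrable `[0, 1[ ((EFin \o A) \- (EFin \o G))%E.
    exact: integrableB.
  exact.
apply: le_trans (le_normr_Rintegral _ iAG) _ => //.
apply: (@le_trans _ _ (\int[mu]_(x in `[0, 1[) (n%:R * (2 * K * N%:R ^- 2)))).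
  apply: le_Rintegral => //; first exact: integrable_norm.
  apply: integrableS
    (continuous_integrable_itv (fun=> n%:R * (2 * K * N%:R ^- 2)) 0 1 _) => //.
    exact: subset_itv_co_cc.
  exact: cst_continuous.
by rewrite Rintegral_cst//= lebesgue_measure_itv/= lte_fin ltr01 oppr0 adde0 mulr1.
Qed.

Lemma grid_averageE (N n : nat) (f : n.-tuple T -> R) :
  grid_average N n f = N%:R ^- n *
    \sum_(k : 'rV['I_N]_n) f [tuple ((k 0 i)%:R / N%:R : R) | i < n].
Proof.
elim: n f => [|n IHn] f /=.
  rewrite expr0 invr1 mul1r (eq_bigr (fun=> f [tuple])) => [|k _]; last first.
    by congr f; apply: eq_from_tnth => -[].
  by rewrite sumr_const card_mx muln0 expn0.
under eq_bigr do rewrite IHn.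
rewrite -mulr_sumr mulrA -invfM -exprS; congr (_ * _).
rewrite pair_big/=.
(* Grid points in dimension n + 1 are pairs of a first index and a grid point in
   dimension n. *)
pose cons (p : 'I_N * 'rV['I_N]_n) : 'rV['I_N]_n.+1 :=
  row_mx (const_mx p.1 : 'M['I_N]_(1, 1)) p.2.
rewrite [RHS](reindex cons)/=; last first.
  exists (fun k : 'rV['I_N]_(1 + n) =>
    (k 0 (lshift n 0), rsubmx k)).
    move=> [j k] _; rewrite /cons /= row_mxKr; congr (_, _).
    by rewrite row_mxEl mxE.
  move=> k' _; pose k : 'rV['I_N]_(1 + n) := k'.
  change (row_mx (const_mx (k 0 (lshift n 0)) : 'M['I_N]_(1, 1)) (rsubmx k) = k).
  have -> : const_mx (k 0 (lshift n 0)) = @lsubmx _ 1 1 n k.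
    by apply/matrixP => i j; rewrite !mxE !ord1.
  exact: (@hsubmxK _ 1 1 n k).
apply: eq_bigr => -[j k] _; congr f; apply: eq_from_tnth => i.
rewrite tnth_mktuple; case: (unliftP ord0 i) => [l ->|->].
  have -> : cons (j, k) 0 (lift ord0 l) = k 0 l.
    rewrite -(row_mxEr (const_mx j : 'M['I_N]_(1, 1)) k); congr (row_mx _ _ _ _).
    exact: val_inj.
  by rewrite tnthS tnth_mktuple.
have -> : cons (j, k) 0 ord0 = j.
  transitivity ((const_mx j : 'M['I_N]_(1, 1)) 0 0); last by rewrite mxE.
  rewrite -(row_mxEl (const_mx j : 'M['I_N]_(1, 1)) k); congr (row_mx _ _ _ _).
  exact: val_inj.
by rewrite tnth0.
Qed.

End grid.

(** * Derivative norms, the site potential and its symmetry *)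

Section derive_norms.
Context {R : realType} {U W : normedModType R}.
Implicit Types (f : U -> W).

Lemma derive_norm_ge (k : nat) f (x : U) (vs : seq U) :
  size vs = k -> all (fun v => `|v| <= 1) vs ->
  (`|iter_derive vs f x|%:E <= derive_norm k f)%E.
Proof.
move=> /eqP sk /allP vs1; apply: ereal_sup_ubound.
exists x; exists (Tuple sk) => // i.
by apply: vs1; exact: mem_tnth.
Qed.

Lemma derive_norm_ge0 (k : nat) f : (0 <= derive_norm k f)%E.
Proof.
apply: le_trans (@derive_norm_ge k f 0 (nseq k 0) (size_nseq _ _) _).
  by rewrite lee_fin.
by apply/allP => v /nseqP[-> _]; rewrite normr0.
Qed.

Lemma derive_norm_le_Ck (k j : nat) f : (j <= k)%N ->
  (derive_norm j f <= Ck_norm k f)%E.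
Proof.
move=> jk; rewrite /Ck_norm (bigD1 (Ordinal (jk : (j < k.+1)%N)))//= leeDl//.
by apply: sume_ge0 => i _; exact: derive_norm_ge0.
Qed.

Lemma derive_dirN f (u x : U) : differentiable f x -> 'D_(- u) f x = - 'D_u f x.
Proof. by move=> df; rewrite !deriveE// linearN. Qed.

Lemma derive_dirNN f (u x : U) : (forall y, differentiable f y) ->
    (forall y, differentiable ('D_u f) y) ->
  'D_(- u) ('D_(- u) f) x = 'D_u ('D_u f) x.
Proof.
move=> df df2.
have -> : 'D_(- u) f = - 'D_u f by apply/funext => y; exact: derive_dirN.
by rewrite deriveN ?derive_dirN ?opprK//; exact: diff_derivable.
Qed.

End derive_norms.

Section directions.
Context {R : realType} {U : normedModType R}.

(** The zero vector has direction 0, so that [dirE] and [dirN] hold without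
    exception. *)
Definition dir (v : U) : U := `|v|^-1 *: v.

Lemma normr_dir v : `|dir v| <= 1.
Proof.
rewrite normrZ normfV normr_id; have [->|v0] := eqVneq v 0.
  by rewrite normr0 mulr0 ler01.
by rewrite mulVf// normr_eq0.
Qed.

Lemma dirE v : v = `|v| *: dir v.
Proof.
rewrite scalerA; have [->|v0] := eqVneq v 0; first by rewrite scaler0.
by rewrite divff ?scale1r// normr_eq0.
Qed.

Lemma dirN v : dir (- v) = - dir v.
Proof. by rewrite /dir normrN scalerN. Qed.

End directions.

Section potential.
Context {R : realType} {U : normedModType R} (V : U -> R) (M : R).
Hypotheses (dV : forall A, differentiable V A)
  (dV2 : forall u A, derivable ('D_u V) A u)
  (V1 : forall u A, `|u| <= 1 -> `|'D_u V A| <= M)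
  (V2 : forall u A, `|u| <= 1 -> `|'D_u ('D_u V) A| <= M).

Lemma diff_dirE (A H : U) : 'd V A H = `|H| * 'D_(dir H) V A.
Proof. by rewrite {1}(dirE H) linearZ -deriveE. Qed.

Lemma normr_diff_le (A H : U) : `|'d V A H| <= M * `|H|.
Proof.
rewrite diff_dirE normrM normr_id mulrC ler_wpM2r//.
by apply: V1; exact: normr_dir.
Qed.

Lemma potential_lipschitz (A B : U) : `|V B - V A| <= M * `|B - A|.
Proof.
have := @line_lipschitz R U V (dir (B - A)) M _ _ A `|B - A|.
rewrite -dirE subrKC normr_id; apply=> y; first exact: diff_derivable.
by apply: V1; exact: normr_dir.
Qed.

(** Used with H a first order approximation of B - A: the first term is the
    curvature of V along B - A and the second one the error made on the
    increment. *)
Lemma potential_taylor (A B H : U) :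
  `|V B - V A - 'd V A H| <= M * `|B - A| ^+ 2 + M * `|B - A - H|.
Proof.
rewrite -(subrKA ('d V A (B - A))) -linearB.
apply: le_trans (ler_normD _ _) _; rewrite lerD ?normr_diff_le//.
have := @line_taylor2 R U V (dir (B - A)) M _ _ _ A `|B - A|.
rewrite -dirE subrKC diff_dirE; apply=> y.
- exact: diff_derivable.
- exact: dV2.
- by apply: V2; exact: normr_dir.
Qed.

End potential.

Section stencils.
Context {R : realType} {d : nat} {Rg : {fset bond d}}.
Local Notation vec := 'rV[R]_d.
Implicit Types (g h : bond d -> vec) (a : R).

Lemma stencilB g h : stencil Rg g - stencil Rg h = stencil Rg (fun b => g b - h b).
Proof. by apply/matrixP => i j; rewrite !mxE. Qed.

Lemma stencilD g h : stencil Rg g + stencil Rg h = stencil Rg (fun b => g b + h b).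
Proof. by apply/matrixP => i j; rewrite !mxE. Qed.

Lemma stencilZ a g : a *: stencil Rg g = stencil Rg (fun b => a *: g b).
Proof. by apply/matrixP => i j; rewrite !mxE. Qed.

Lemma norm_stencil_le g a : 0 <= a -> (forall b, b \in Rg -> `|g b| <= a) ->
  `|stencil Rg g| <= a.
Proof.
move=> a0 ga; apply/mx_norm_leP => // i j; rewrite mxE.
by apply: le_trans (le_mx_norm _ _ _) (ga _ (valP (enum_val i))).
Qed.

(** The line t |-> g + t h is mapped to t |-> g - t h by the symmetry, hence V is
    even along it. *)
Lemma point_symmetric_diff_eq0 (V : 'M[R]_(#|{: Rg}|, d) -> R) g h :
    point_symmetric V -> (forall A, differentiable V A) ->
    (forall b, g (bond_neg b) = - g b) -> (forall b, h (bond_neg b) = h b) ->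
  'd V (stencil Rg g) (stencil Rg h) = 0.
Proof.
move=> [_ Vsym] dV gN hN.
suff : 'D_(stencil Rg h) V (stencil Rg g) = 'D_(- stencil Rg h) V (stencil Rg g).
  by rewrite derive_dirN// -deriveE//; move: ('D_ _ _ _) => z zN; lra.
(* Evenness makes the difference quotients in directions h and - h equal, and the
   derivative is odd in the direction. *)
have even k : V (k *: - stencil Rg h + stencil Rg g) =
    V (k *: stencil Rg h + stencil Rg g).
  rewrite scalerN -scaleNr !stencilZ !stencilD [RHS]Vsym; congr (V _).
  by apply/matrixP => i j; rewrite !mxE gN hN !mxE opprD opprK mulNr.
rewrite /derive; set q := (X in _ = lim (X @ _)).
suff -> : q = (fun k : R => k^-1 *:
  ((V \o shift (stencil Rg g)) (k *: stencil Rg h) - V (stencil Rg g))) by [].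
by apply/funext => k; rewrite /q/= even.
Qed.

End stencils.

(** * Bond gradients, finite differences and the energy error *)

(** All the bond estimates have this shape, with one term from Y and one from
    P. *)
Lemma normr_comb_le {R : realType} {W : normedModType R} (k l r A B : R)
    (u v : W) : `|k| <= r -> `|u| <= A -> `|l| <= 1 -> `|v| <= B ->
  `|k *: u + l *: v| <= r * A + B.
Proof.
move=> kr uA l1 vB; apply: le_trans (ler_normD _ _) _; rewrite !normrZ.
apply: lerD; first exact: ler_pM.
by rewrite -[leRHS]mul1r ler_pM.
Qed.

(** The bound, up to the factor M, on the quadratic remainder of the energy
    density: square of the first order increment of the bond gradients plus
    their second order remainder.  Here c bounds the lengths of the bonds and
    the other arguments stand for the norms of D^2 Y, D^3 Y, D P and D^2 P. *)
Definition energy_modulus {R : realType} (c a2 a3 p1 p2 : R) : R :=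
  (c * a2 + p1) ^+ 2 + (c * a3 + p2).

(** Since c >= 1, all powers of c are absorbed into c^4; the cross term of the
    square is absorbed by (c a2 - p1)^2 >= 0. *)
Lemma energy_modulus_le {R : realType} {c a3 p2 : R} (a2 p1 : R) :
    1 <= c -> 0 <= a3 -> 0 <= p2 ->
  c ^+ 2 * energy_modulus c a2 a3 p1 p2
    <= 2 * c ^+ 4 * (a3 + p2 + a2 ^+ 2 + p1 ^+ 2).
Proof.
move=> c1 a30 p20.
have -> : 2 * c ^+ 4 * (a3 + p2 + a2 ^+ 2 + p1 ^+ 2) =
  c ^+ 2 * (2 * c ^+ 2 * (a3 + p2 + a2 ^+ 2 + p1 ^+ 2)) by ring.
apply: ler_wpM2l; first exact: sqr_ge0.
rewrite /energy_modulus.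
have c0 : 0 <= c by exact: le_trans ler01 c1.
have sq := sqr_ge0 (c * a2 - p1).
have c21 : 1 <= c ^+ 2 by rewrite exprn_ege1.
have cc2 : c <= c ^+ 2 by rewrite expr2 ler_peMl.
have h1 : c * a3 <= c ^+ 2 * a3 by rewrite ler_wpM2r.
have h2 : p2 <= c ^+ 2 * p2 by rewrite ler_peMl.
have h3 : p1 ^+ 2 <= c ^+ 2 * p1 ^+ 2 by rewrite ler_peMl// sqr_ge0.
have h4 : 0 <= c ^+ 2 * a3 by rewrite mulr_ge0// sqr_ge0.
have h5 : 0 <= c ^+ 2 * p2 by rewrite mulr_ge0// sqr_ge0.
by nra.
Qed.

Section fields.
Context {R : realType} {d : nat} (Rg : {fset bond d}).
Local Notation vec := 'rV[R]_d.
Context (Y P : vec -> vec) (c a2 a3 p1 p2 : R).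
Hypotheses (c1 : 1 <= c)
  (cRg : forall b : bond d, b \in Rg -> `|emb b.1.1 : vec| <= c).
Hypotheses (dY : forall x, differentiable Y x)
  (dY1 : forall u x, differentiable ('D_u Y) x)
  (dY2 : forall u v x, differentiable ('D_v ('D_u Y)) x)
  (dP : forall x, differentiable P x)
  (dP1 : forall u x, differentiable ('D_u P) x).
Hypotheses
  (Y2 : forall u v x, `|u| <= 1 -> `|v| <= 1 -> `|'D_v ('D_u Y) x| <= a2)
  (Y3 : forall u v w x, `|u| <= 1 -> `|v| <= 1 -> `|w| <= 1 ->
     `|'D_w ('D_v ('D_u Y)) x| <= a3)
  (P1 : forall u x, `|u| <= 1 -> `|'D_u P x| <= p1)
  (P2 : forall u v x, `|u| <= 1 -> `|v| <= 1 -> `|'D_v ('D_u P) x| <= p2).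
Implicit Types (x e : vec) (t : R) (b : bond d).

Let c0 : 0 <= c. Proof. exact: le_trans ler01 c1. Qed.
Let n0 : `|0 : vec| <= 1. Proof. by rewrite normr0 ler01. Qed.
Let a20 : 0 <= a2. Proof. exact: le_trans (normr_ge0 _) (Y2 0 0 0 n0 n0). Qed.
Let a30 : 0 <= a3. Proof. exact: le_trans (normr_ge0 _) (Y3 0 0 0 0 n0 n0 n0). Qed.
Let p10 : 0 <= p1. Proof. exact: le_trans (normr_ge0 _) (P1 0 0 n0). Qed.
Let p20 : 0 <= p2. Proof. exact: le_trans (normr_ge0 _) (P2 0 0 0 n0 n0). Qed.

Definition bond_len b : R := `|emb b.1.1 : vec|.
Definition bond_dir b : vec := dir (emb b.1.1).
(** The coefficient of the shift field in the bond gradient. *)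
Definition bond_jump b : R := b.2%:R - b.1.2%:R.
(** The position of the end point of the bond relative to the deformation field,
    in units of the shift: - 1/2 or 1/2. *)
Definition end_shift b : R := b.2%:R - 2^-1.

Lemma bond_gradE x b : bond_grad Y P x b =
  bond_len b *: 'D_(bond_dir b) Y x + bond_jump b *: P x.
Proof.
case: b => [[rho al] be]; rewrite /bond_grad /bond_len /bond_dir /=.
by rewrite {1}(dirE (emb rho)) linearZ deriveE.
Qed.

Lemma bond_jump_le1 b : `|bond_jump b| <= 1.
Proof.
case: b => [[rho [|]] [|]]; rewrite /bond_jump/= ?subrr ?normr0 ?ler01//.
  by rewrite sub0r normrN normr1.
by rewrite subr0 normr1.
Qed.

Lemma end_shift_le1 b : `|end_shift b| <= 1.
Proof. by case: b => [[rho al] [|]]; rewrite /end_shift/= ler_norml; lra. Qed.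

Definition bond_grad_deriv e x b : vec :=
  bond_len b *: 'D_e ('D_(bond_dir b) Y) x + bond_jump b *: 'D_e P x.

Lemma bond_grad_lipschitz e x t : `|e| <= 1 ->
  `|stencil Rg (bond_grad Y P (x + t *: e)) - stencil Rg (bond_grad Y P x)|
    <= (c * a2 + p1) * `|t|.
Proof.
move=> e1; rewrite stencilB; apply: norm_stencil_le => [|b bRg].
  by rewrite mulr_ge0// addr_ge0// mulr_ge0.
rewrite !bond_gradE opprD addrACA -!scalerBr mulrDl -mulrA.
apply: normr_comb_le (bond_jump_le1 b) _.
- by rewrite normr_id; exact: cRg.
- apply: (line_lipschitz_mx ('D_(bond_dir b) Y) e a2) => y.
    exact: diff_derivable.
  exact: (Y2 _ _ _ (normr_dir _) e1).
- apply: (line_lipschitz_mx P e p1) => y; first exact: diff_derivable.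
  exact: P1.
Qed.

Lemma bond_grad_taylor e x t : `|e| <= 1 ->
  `|stencil Rg (bond_grad Y P (x + t *: e)) - stencil Rg (bond_grad Y P x)
    - t *: stencil Rg (bond_grad_deriv e x)| <= (c * a3 + p2) * t ^+ 2.
Proof.
move=> e1; rewrite stencilZ !stencilB; apply: norm_stencil_le => [|b bRg].
  by rewrite mulr_ge0 ?sqr_ge0// addr_ge0// mulr_ge0.
rewrite !bond_gradE /bond_grad_deriv.
have -> (l j : R) (y' y dy p' p dp : vec) :
    l *: y' + j *: p' - (l *: y + j *: p) - t *: (l *: dy + j *: dp) =
    l *: (y' - y - t *: dy) + j *: (p' - p - t *: dp).
  by apply/rowP => i; rewrite !mxE; ring.
rewrite mulrDl -mulrA.
apply: normr_comb_le (bond_jump_le1 b) _.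
- by rewrite normr_id; exact: cRg.
- apply: (line_taylor2_mx ('D_(bond_dir b) Y) e a3) => y.
  + exact: diff_derivable.
  + exact: diff_derivable.
  + exact: (Y3 _ _ _ _ (normr_dir _) e1 e1).
- apply: (line_taylor2_mx P e p2) => y.
  + exact: diff_derivable.
  + exact: diff_derivable.
  + exact: P2.
Qed.

(** The coefficient of 1/N in the expansion of a finite difference around the
    bond gradient. *)
Definition bond_defect x b : vec :=
  (bond_len b ^+ 2 / 2) *: 'D_(bond_dir b) ('D_(bond_dir b) Y) x
  + (end_shift b * bond_len b) *: 'D_(bond_dir b) P x.

Lemma bond_grad_neg x b : bond_grad Y P x (bond_neg b) = - bond_grad Y P x b.
Proof.
case: b => [[rho al] be]; rewrite /bond_grad /bond_neg/= /emb map_mxN linearN.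
rewrite opprD -scaleNr; congr (_ + _ *: _).
by case: al; case: be; rewrite /=; lra.
Qed.

(** Both terms are even: the first one is quadratic in the direction, and in the
    second one the shift of the end point changes sign with the direction. *)
Lemma bond_defect_neg x b : bond_defect x (bond_neg b) = bond_defect x b.
Proof.
case: b => [[rho al] be]; rewrite /bond_defect /bond_len /bond_dir /end_shift/=.
rewrite /emb map_mxN normrN dirN; set u := dir _.
have E1 : 'D_(- u) ('D_(- u) Y) x = 'D_u ('D_u Y) x.
  exact: (derive_dirNN Y u x dY (dY1 u)).
have E2 : 'D_(- u) P x = - 'D_u P x := derive_dirN P u x (dP x).
rewrite E1 E2.
congr (_ + _); rewrite scalerN -scaleNr -mulNr; congr (_ * _ *: _).
by case: be; rewrite /=; lra.
Qed.

Section site.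
Context (N : nat) (N0 : (0 < N)%N) (xi : 'rV[int]_d).
Let eps : R := N%:R^-1.
Let x : vec := eps *: emb xi.
Let fd := finite_diff (sampled_deformation N Y P) xi.

Lemma sampled_deformationE (eta : 'rV[int]_d) (al : bool) :
  sampled_deformation N Y P eta al =
  N%:R *: Y (eps *: emb eta) + (al%:R - 2^-1) *: P (eps *: emb eta).
Proof.
rewrite /sampled_deformation /scale_def /scale_shift; case: al => /=.
  by congr (_ + _ *: _); lra.
by rewrite sub0r scaleNr.
Qed.

Let eps0 : 0 < eps. Proof. by rewrite invr_gt0 ltr0n. Qed.
Let Neps : N%:R * eps = 1. Proof. by rewrite mulfV// pnatr_eq0 -lt0n. Qed.

Let step b := eps * bond_len b.

Let step0 b : 0 <= step b. Proof. apply: mulr_ge0; [exact: ltW|exact: normr_ge0]. Qed.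

(* The deformation of both end points is expanded at x; N times the step is the
   length of the bond, which turns N 'D Y into the bond gradient. *)
Let fdE b : fd b - bond_grad Y P x b =
  N%:R *: (Y (x + step b *: bond_dir b) - Y x - step b *: 'D_(bond_dir b) Y x)
  + end_shift b *: (P (x + step b *: bond_dir b) - P x).
Proof.
rewrite bond_gradE; case: b => [[rho al] be].
rewrite /fd/= !sampled_deformationE embD scalerDr {1 2}(dirE (emb rho)) scalerA.
rewrite -/x /step /bond_len /bond_dir /bond_jump /end_shift/=.
have key (l be' al' : R) (y' y dy p' p : vec) :
    N%:R *: y' + (be' - 2^-1) *: p' - (N%:R *: y + (al' - 2^-1) *: p)
      - (l *: dy + (be' - al') *: p) =
    N%:R *: (y' - y - (eps * l) *: dy) + (be' - 2^-1) *: (p' - p).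
  have {1}-> : l = N%:R * eps * l by rewrite Neps mul1r.
  by apply/rowP => i; rewrite !mxE; ring.
exact: key.
Qed.

Lemma finite_diff_lipschitz :
  `|stencil Rg fd - stencil Rg (bond_grad Y P x)| <= eps * (c ^+ 2 * a2 + c * p1).
Proof.
rewrite stencilB; apply: norm_stencil_le => [|b bRg].
  by rewrite mulr_ge0 ?(ltW eps0)// addr_ge0// mulr_ge0// sqr_ge0.
rewrite fdE; have lc := cRg b bRg; have l0 : 0 <= bond_len b by exact: normr_ge0.
have Y2b := line_taylor2_mx Y (bond_dir b) a2 (fun y => diff_derivable (dY y))
  (fun y => diff_derivable (dY1 _ y))
  (fun y => Y2 _ _ y (normr_dir _) (normr_dir _)) x (step b).
have P1b := line_lipschitz_mx P (bond_dir b) p1 (fun y => diff_derivable (dP y))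
  (fun y => P1 _ y (normr_dir _)) x (step b).
have comb := normr_comb_le N%:R (end_shift b) _ _ _ _ _
  (lexx _) Y2b (end_shift_le1 b) P1b.
apply: le_trans comb _.
rewrite normr_nat (ger0_norm (step0 b)) /step.
have -> : N%:R * (a2 * (eps * bond_len b) ^+ 2) + p1 * (eps * bond_len b) =
    eps * (N%:R * eps * (bond_len b ^+ 2 * a2) + bond_len b * p1) by ring.
rewrite Neps mul1r; apply: ler_wpM2l; first exact: ltW.
apply: lerD; apply: ler_wpM2r => //.
by apply: lerXn2r; rewrite ?nnegrE.
Qed.

(** The step along the bond is eps times its length: the cubic remainder of Y is
    multiplied by N and the quadratic remainder of P enters as it is, which makes
    both of order eps^2. *)
Lemma finite_diff_taylor :
  `|stencil Rg fd - stencil Rg (bond_grad Y P x)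
    - eps *: stencil Rg (bond_defect x)|
    <= eps ^+ 2 * (c ^+ 3 * a3 + c ^+ 2 * p2).
Proof.
rewrite stencilZ !stencilB; apply: norm_stencil_le => [|b bRg].
  by rewrite mulr_ge0 ?sqr_ge0// addr_ge0// mulr_ge0// exprn_ge0.
have lc := cRg b bRg; have l0 : 0 <= bond_len b by exact: normr_ge0.
have -> : fd b - bond_grad Y P x b - eps *: bond_defect x b =
  N%:R *: (Y (x + step b *: bond_dir b) - Y x - step b *: 'D_(bond_dir b) Y x
           - (step b ^+ 2 / 2) *: 'D_(bond_dir b) ('D_(bond_dir b) Y) x)
  + end_shift b *: (P (x + step b *: bond_dir b) - P x
           - step b *: 'D_(bond_dir b) P x).
  rewrite fdE /bond_defect /step.
  have key (l h : R) (y dy ddy p dp : vec) :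
      N%:R *: y + h *: p - eps *: ((l ^+ 2 / 2) *: ddy + (h * l) *: dp) =
      N%:R *: (y - ((eps * l) ^+ 2 / 2) *: ddy) + h *: (p - (eps * l) *: dp).
    have E : N%:R * ((eps * l) ^+ 2 / 2) = eps * (l ^+ 2 / 2).
      transitivity (N%:R * eps * (eps * (l ^+ 2 / 2))); first by ring.
      by rewrite Neps mul1r.
    rewrite scalerBr scalerA E; apply/rowP => i; rewrite !mxE; ring.
  exact: key.
have Y3b := line_taylor3_mx Y (bond_dir b) a3 (fun y => diff_derivable (dY y))
  (fun y => diff_derivable (dY1 _ y)) (fun y => diff_derivable (dY2 _ _ y))
  (fun y => Y3 _ _ _ y (normr_dir _) (normr_dir _) (normr_dir _)) x (step b).
have P2b := line_taylor2_mx P (bond_dir b) p2 (fun y => diff_derivable (dP y))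
  (fun y => diff_derivable (dP1 _ y))
  (fun y => P2 _ _ y (normr_dir _) (normr_dir _)) x (step b).
have comb := normr_comb_le N%:R (end_shift b) _ _ _ _ _
  (lexx _) Y3b (end_shift_le1 b) P2b.
apply: le_trans comb _.
rewrite normr_nat (ger0_norm (step0 b)) /step.
have -> : N%:R * (a3 * (eps * bond_len b) ^+ 3)
    + p2 * (eps * bond_len b) ^+ 2 =
  eps ^+ 2 * (N%:R * eps * (bond_len b ^+ 3 * a3) + bond_len b ^+ 2 * p2) by ring.
rewrite Neps mul1r; apply: ler_wpM2l; first exact: sqr_ge0.
by apply: lerD; apply: ler_wpM2r => //; apply: lerXn2r; rewrite ?nnegrE.
Qed.

End site.


Section energy.
Context (V : 'M[R]_(#|{: Rg}|, d) -> R) (M : R).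
Hypotheses (dV : forall A, differentiable V A)
  (dV2 : forall u A, derivable ('D_u V) A u)
  (V0 : forall A, `|V A| <= M)
  (V1 : forall u A, `|u| <= 1 -> `|'D_u V A| <= M)
  (V2 : forall u A, `|u| <= 1 -> `|'D_u ('D_u V) A| <= M)
  (Vsym : point_symmetric V) (YPper : field_periodic 1 Y P).

Let M0 : 0 <= M. Proof. exact: le_trans (normr_ge0 _) (V0 0). Qed.

Local Notation modulus := (energy_modulus c a2 a3 p1 p2).

Definition cb_density x : R := V (stencil Rg (bond_grad Y P x)).

(** The term of order 1/N has the value 'd V at the bond gradients applied to the
    defect, which vanishes by symmetry. *)
Lemma site_energy_error (N : nat) (xi : 'rV[int]_d) : (0 < N)%N ->
  `|V (stencil Rg (finite_diff (sampled_deformation N Y P) xi))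
    - cb_density (N%:R^-1 *: emb xi)| <= M * c ^+ 2 * modulus * N%:R ^- 2.
Proof.
move=> N0; pose x : vec := N%:R^-1 *: emb xi.
have T := potential_taylor V M dV dV2 V1 V2 (stencil Rg (bond_grad Y P x))
  (stencil Rg (finite_diff (sampled_deformation N Y P) xi))
  (N%:R^-1 *: stencil Rg (bond_defect x)).
have dV0 : 'd V (stencil Rg (bond_grad Y P x)) (stencil Rg (bond_defect x)) = 0.
  apply: (point_symmetric_diff_eq0 V (bond_grad Y P x) (bond_defect x) Vsym dV).
    exact: bond_grad_neg.
  exact: bond_defect_neg.
have dVH : 'd V (stencil Rg (bond_grad Y P x))
    (N%:R^-1 *: stencil Rg (bond_defect x)) = 0.
  by rewrite linearZ dV0; exact: mulr0.
rewrite dVH subr0 in T; apply: le_trans T _.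
have L := finite_diff_lipschitz N N0 xi; have Q := finite_diff_taylor N N0 xi.
have -> : M * c ^+ 2 * modulus * N%:R ^- 2 =
    M * (N%:R^-1 * (c ^+ 2 * a2 + c * p1)) ^+ 2
    + M * (N%:R^-1 ^+ 2 * (c ^+ 3 * a3 + c ^+ 2 * p2)).
  by rewrite -exprVn /energy_modulus; ring.
apply: lerD; apply: (ler_wpM2l M0); last exact: Q.
apply: lerXn2r; last exact: L.
  exact: normr_ge0.
exact: le_trans (normr_ge0 _) L.
Qed.

Lemma cb_density_lipschitz x y :
  `|cb_density x - cb_density y| <= M * ((c * a2 + p1) * `|x - y|).
Proof.
apply: le_trans (potential_lipschitz V M dV V1 _ _) _.
apply: ler_wpM2l => //.
have := bond_grad_lipschitz (dir (x - y)) y `|x - y| (normr_dir _).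
by rewrite -dirE subrKC normr_id.
Qed.

Lemma cb_density_periodic x (eta : 'rV[int]_d) :
  cb_density (x + emb eta) = cb_density x.
Proof.
have [B _ per] := YPper.
have PE z : P (z + emb eta) = P z.
  by have [] := per z eta; rewrite scale1r.
have YE z : Y (z + emb eta) = emb eta *m B^T + Y z.
  by have [_] := per z eta; rewrite !scale1r.
have DE u : 'D_u Y (x + emb eta) = 'D_u Y x.
  rewrite /derive; set q := (X in lim (X @ _) = _).
  suff -> : q = (fun k : R => k^-1 *: ((Y \o shift x) (k *: u) - Y x)) by [].
  apply/funext => k; rewrite /q/= addrA !YE; congr (_ *: _).
  by rewrite opprD addrACA subrr add0r.
rewrite /cb_density; congr (V (stencil Rg _)); apply/funext => b.
by rewrite !bond_gradE PE DE.
Qed.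

(** The slope at s is the derivative of V at the bond gradients, applied to the
    derivative of the bond gradients along the axis. *)
Lemma cb_density_periodic_quadratic x (i : 'I_d) :
  periodic_quadratic (M * modulus)
    (fun s => cb_density (x + s *: delta_mx 0 i)).
Proof.
set e : vec := delta_mx 0 i.
have eE : e = emb (delta_mx 0 i).
  by apply/rowP => j; rewrite !mxE; case: (_ && _).
have e1 : `|e| <= 1.
  apply/mx_norm_leP => // j k; rewrite mxE.
  by case: (_ && _); rewrite ?normr1// normr0 ler01.
split; first by rewrite scale1r scale0r addr0 eE cb_density_periodic.
exists (fun s => 'd V (stencil Rg (bond_grad Y P (x + s *: e)))
  (stencil Rg (bond_grad_deriv e (x + s *: e)))) => s t.
have ste : x + t *: e = x + s *: e + (t - s) *: e by rewrite -addrA -scalerDl subrKC.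
move: (x + s *: e) ste => z ste.
have T := potential_taylor V M dV dV2 V1 V2 (stencil Rg (bond_grad Y P z))
  (stencil Rg (bond_grad Y P (x + t *: e)))
  ((t - s) *: stencil Rg (bond_grad_deriv e z)).
have dVZ : 'd V (stencil Rg (bond_grad Y P z))
      ((t - s) *: stencil Rg (bond_grad_deriv e z)) =
    'd V (stencil Rg (bond_grad Y P z)) (stencil Rg (bond_grad_deriv e z)) * (t - s).
  by rewrite linearZ mulrC.
rewrite dVZ in T; apply: le_trans T _.
rewrite ste -mulrA -mulrDr; apply: ler_wpM2l => //.
rewrite /energy_modulus mulrDl; apply: lerD; last exact: bond_grad_taylor.
rewrite -(real_normK (num_real (t - s))) -exprMn.
have L := bond_grad_lipschitz e z (t - s) e1.
apply: lerXn2r; last exact: L.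
  exact: normr_ge0.
exact: le_trans (normr_ge0 _) L.
Qed.

(** The site errors are averaged over the grid, and the quadrature error is d
    times the one-dimensional one with constant 2 M modulus; c^2 >= 1 puts both
    under one bound. *)
Lemma energy_error (N : nat) : (0 < N)%N ->
  `|N%:R ^- d * atom_energy V N (sampled_deformation N Y P) - cb_energy V Y P|
    <= (1 + 2 * d%:R) * (M * c ^+ 2 * modulus * N%:R ^- 2).
Proof.
move=> N0; pose f (t : d.-tuple (measurableTypeR R)) : R :=
  cb_density (\row_i tnth t i).
have Lf : 0 <= M * (c * a2 + p1) by apply: mulr_ge0 => //; rewrite addr_ge0// mulr_ge0.
have mf : measurable_fun setT f.
  apply: (@measurable_lipschitz R d f (M * (c * a2 + p1))) => // s t r r0 str.
  apply: le_trans (cb_density_lipschitz _ _) _; rewrite mulrA.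
  apply: ler_wpM2l => //; apply/mx_norm_leP => // i j; rewrite !mxE; exact: str.
have fM (t : d.-tuple (measurableTypeR R)) : `|f t| <= M by exact: V0.
have pqf i (t : d.-tuple (measurableTypeR R)) :
    periodic_quadratic (M * modulus)
      (fun s : R => f [tuple if j == i then s else tnth t j | j < d]).
  have := cb_density_periodic_quadratic (\row_j if j == i then 0 else tnth t j) i.
  congr periodic_quadratic; apply/funext => s; congr cb_density.
  apply/rowP => j; rewrite !mxE tnth_mktuple eqxx/=.
  by case: eqP => _; rewrite ?mulr1 ?add0r// mulr0 addr0.
have := grid_quadrature N d _ M f N0 mf fM pqf.
rewrite grid_averageE -[\int[_]_(_ in _) _]/(cb_energy V Y P).
set I := cb_energy V Y P => quad.
have e0 : 0 <= N%:R ^- d :> R by rewrite invr_ge0 exprn_ge0.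
have atom : `|N%:R ^- d * atom_energy V N (sampled_deformation N Y P)
    - N%:R ^- d * \sum_(k : 'rV['I_N]_d) f [tuple ((k 0 i)%:R / N%:R : R) | i < d]|
    <= M * c ^+ 2 * modulus * N%:R ^- 2.
  rewrite -mulrBr -sumrB normrM (ger0_norm e0) mulrC ler_pdivrMr; last first.
    by rewrite exprn_gt0// ltr0n.
  apply: le_trans (ler_norm_sum _ _ _) _.
  apply: (@le_trans _ _ (\sum_(k : 'rV['I_N]_d)
      M * c ^+ 2 * modulus * N%:R ^- 2)).
    apply: ler_sum => k _.
    have := site_energy_error N (map_mx (fun i : 'I_N => (i : nat)%:Z) k) N0.
    congr (`|_ - cb_density _| <= _).
    by apply/rowP => i; rewrite !mxE tnth_mktuple mulrC.
  by rewrite sumr_const card_mx card_ord mul1n -[leLHS]mulr_natr natrX.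
rewrite -(subrKA (N%:R ^- d *
  \sum_(k : 'rV['I_N]_d) f [tuple ((k 0 i)%:R / N%:R : R) | i < d])).
apply: le_trans (ler_normD _ _) _; rewrite mulrDl mul1r.
apply: lerD => //; rewrite distrC; apply: le_trans quad _.
have m0 : 0 <= modulus by rewrite addr_ge0 ?sqr_ge0// addr_ge0// mulr_ge0.
have mc : modulus <= c ^+ 2 * modulus by rewrite ler_peMl// exprn_ege1.
have -> : 2 * d%:R * (M * c ^+ 2 * modulus / N%:R ^+ 2) =
  d%:R * (2 * (M * (c ^+ 2 * modulus)) / N%:R ^+ 2) by ring.
apply: ler_wpM2l => //; apply: ler_wpM2r; first by rewrite invr_ge0 exprn_ge0.
by apply: ler_wpM2l => //; apply: ler_wpM2l.
Qed.

End energy.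

End fields.

(** * The convergence estimate *)

Lemma emb_bounded {R : realType} {d : nat} (Rg : {fset bond d}) :
  exists2 c : R, 1 <= c & forall b, b \in Rg -> `|emb b.1.1 : 'rV[R]_d| <= c.
Proof.
exists (1 + \sum_(i : Rg) `|emb (val i).1.1 : 'rV[R]_d|).
  by rewrite lerDl sumr_ge0.
move=> b bRg; rewrite (bigD1 [` bRg]%fset)//= addrCA lerDl addr_ge0//.
exact: sumr_ge0.
Qed.

Lemma fin_num_expe2 {R : realType} (x : \bar R) :
  (x ^+ 2)%E \is a fin_num -> x \is a fin_num.
Proof. by case: x => [r| |]//=; rewrite expe2 ?mulyy ?mulNyNy. Qed.

Theorem theorem5p1 (R : realType) (d : nat) (hd : (1 <= d <= 3)%N)
    (Rg : {fset bond d}) (hRg : interaction_range Rg) :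
  exists C : R -> R,
  forall (V : 'M[R]_(#|{: Rg}|, d) -> R) (M : R),
    Ck 3 V -> point_symmetric V -> Ck_norm 2 V = M%:E ->
  forall Y P : 'rV[R]_d -> 'rV[R]_d,
    Ck 3 Y -> Ck 2 P -> field_periodic 1 Y P ->
  forall N : nat, (0 < N)%N ->
    (`| N%:R ^- d * atom_energy V N (sampled_deformation N Y P)
        - cb_energy V Y P |%:E
     <= (C M * N%:R ^- 2)%:E *
        (derive_norm 3 Y + derive_norm 2 P
         + derive_norm 2 Y ^+ 2 + derive_norm 1 P ^+ 2))%E.
Proof.
have [c c1 cRg] := @emb_bounded R d Rg.
exists (fun M => (1 + 2 * d%:R) * (2 * c ^+ 4) * (M + 1)).
move=> V M CV Vsym VM Y P CY CP YPper N N0.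
have Vle j : (j <= 2)%N -> (derive_norm j V <= M%:E)%E.
  by move=> j2; rewrite -VM; exact: derive_norm_le_Ck.
have M0 : 0 <= M by rewrite -lee_fin (le_trans (derive_norm_ge0 0 V))// Vle.
(* The constant is positive, so that an infinite norm on the right makes the
   estimate trivial and all the norms can be assumed finite. *)
set A := (1 + 2 * d%:R) * (2 * c ^+ 4).
have A0 : 0 < A.
  by rewrite !mulr_gt0 ?exprn_gt0 ?(lt_le_trans ltr01 c1)// ltr_pwDl ?mulr_ge0.
have e0 : 0 < N%:R ^- 2 :> R by rewrite invr_gt0 exprn_gt0// ltr0n.
have D0 : 0 < A * (M + 1) * N%:R ^- 2 by rewrite mulr_gt0// mulr_gt0// ltr_wpDl.
set S := (derive_norm 3 Y + _ + _ + _)%E.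
have S0 : (0 <= S)%E.
  by rewrite /S !adde_ge0 ?expe_ge0 ?derive_norm_ge0.
have [Sfin|] := boolP (S \is a fin_num); last first.
  by rewrite ge0_fin_numE// -leNgt leye_eq => /eqP ->; rewrite gt0_muley ?leey.
move: (Sfin); rewrite {1}/S !fin_numD => /andP[/andP[/andP[Y3fin P2fin]]].
move=> /fin_num_expe2 Y2fin /fin_num_expe2 P1fin.
pose a3 := fine (derive_norm 3 Y); pose p2 := fine (derive_norm 2 P).
pose a2 := fine (derive_norm 2 Y); pose p1 := fine (derive_norm 1 P).
have SE : S = (a3 + p2 + a2 ^+ 2 + p1 ^+ 2)%:E.
  by rewrite /S -(fineK Y3fin) -(fineK P2fin) -(fineK Y2fin) -(fineK P1fin).
have [dY {}CY] := CY; have dY1 u := (CY u).1; have dY2 u v := ((CY u).2 v).1.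
have [dP {}CP] := CP; have dP1 u := (CP u).1.
have [dV {}CV] := CV; have dV1 u := (CV u).1.
have Y2 u v x : `|u| <= 1 -> `|v| <= 1 -> `|'D_v ('D_u Y) x| <= a2.
  move=> u1 v1; rewrite -lee_fin (fineK Y2fin).
  by apply: (@derive_norm_ge _ _ _ 2 Y x [:: v; u]) => //=; rewrite u1 v1.
have Y3 u v w x : `|u| <= 1 -> `|v| <= 1 -> `|w| <= 1 ->
    `|'D_w ('D_v ('D_u Y)) x| <= a3.
  move=> u1 v1 w1; rewrite -lee_fin (fineK Y3fin).
  by apply: (@derive_norm_ge _ _ _ 3 Y x [:: w; v; u]) => //=; rewrite u1 v1 w1.
have P1 u x : `|u| <= 1 -> `|'D_u P x| <= p1.
  move=> u1; rewrite -lee_fin (fineK P1fin).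
  by apply: (@derive_norm_ge _ _ _ 1 P x [:: u]) => //=; rewrite u1.
have P2 u v x : `|u| <= 1 -> `|v| <= 1 -> `|'D_v ('D_u P) x| <= p2.
  move=> u1 v1; rewrite -lee_fin (fineK P2fin).
  by apply: (@derive_norm_ge _ _ _ 2 P x [:: v; u]) => //=; rewrite u1 v1.
have V0 B : `|V B| <= M.
  rewrite -lee_fin; apply: le_trans (Vle 0%N isT).
  exact: (@derive_norm_ge _ _ _ 0 V B [::]).
have V1 u B : `|u| <= 1 -> `|'D_u V B| <= M.
  move=> u1; rewrite -lee_fin; apply: le_trans (Vle 1%N isT).
  by apply: (@derive_norm_ge _ _ _ 1 V B [:: u]) => //=; rewrite u1.
have V2 u B : `|u| <= 1 -> `|'D_u ('D_u V) B| <= M.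
  move=> u1; rewrite -lee_fin; apply: le_trans (Vle 2%N isT).
  by apply: (@derive_norm_ge _ _ _ 2 V B [:: u; u]) => //=; rewrite u1.
(* From here on the four norms are the real numbers a2, a3, p1, p2. *)
have err := energy_error Rg Y P c a2 a3 p1 p2 c1 cRg dY dY1 dY2 dP dP1
  Y2 Y3 P1 P2 V M dV (fun u A => diff_derivable (dV1 u A)) V0 V1 V2 Vsym YPper
  N N0.
rewrite SE -EFinM lee_fin; apply: le_trans err _.
have mod_le := energy_modulus_le a2 p1 c1
  (fine_ge0 (derive_norm_ge0 3 Y)) (fine_ge0 (derive_norm_ge0 2 P)).
rewrite -/a3 -/p2 in mod_le.
set m := energy_modulus _ _ _ _ _ in mod_le *.
set s := a3 + _ + _ + _ in mod_le *.
have s0 : 0 <= s by rewrite -lee_fin -SE.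
have -> : (1 + 2 * d%:R) * (M * c ^+ 2 * m * N%:R ^- 2) =
  (1 + 2 * d%:R) * N%:R ^- 2 * (M * (c ^+ 2 * m)) by ring.
have -> : A * (M + 1) * N%:R ^- 2 * s =
  (1 + 2 * d%:R) * N%:R ^- 2 * ((M + 1) * (2 * c ^+ 4 * s)) by rewrite /A; ring.
apply: ler_wpM2l; first by rewrite mulr_ge0 ?(ltW e0)// addr_ge0// mulr_ge0.
apply: (@le_trans _ _ (M * (2 * c ^+ 4 * s))); first exact: ler_wpM2l.
apply: ler_wpM2r; last by rewrite lerDl.
by rewrite mulr_ge0// mulr_ge0// exprn_ge0// (le_trans ler01 c1).
Qed.
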